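(* In the unconstrained fluid model, the unique socially optimal strategy (the arrival distribution minimizing the social cost) has a uniform density of $\dfrac{\mu}{\Lambda}$ along $\left[-\dfrac{\beta_2\Lambda}{(\beta_1+\beta_2)\mu},\ \dfrac{\beta_1\Lambda}{(\beta_1+\beta_2)\mu}\right]$. The corresponding social cost is $\dfrac{\beta_1\beta_2\Lambda^2}{2(\beta_1+\beta_2)\mu}$.
   Context: Fluid model. A continuum of infinitesimal customers (drops) of total deterministic volume $\Lambda>0$ each have an arrival time. The server works first-come-first-served and serves volume at rate $\mu>0$ whenever there is a queue; a drop finding volume $\eta$ in the queue upon arrival waits exactly $\eta/\mu$. A drop arriving at $t_1$ and served at $t_2\ge t_1$ pays $\beta_1\max(-t_1,0)$ (earliness) $+\ \alpha(t_2-t_1)$ (waiting) $+\ \beta_2\max(t_2,0)$ (tardiness), with $\alpha,\beta_1,\beta_2>0$. $F(t)$ denotes the proportion of drops that arrived prior to time $t$; a density refers to $F$. In the unconstrained model, any arrival time in $\mathbb{R}$ is allowed. The social cost of an arrival distribution is the total cost of all drops. *)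

(* Defs.v *)
From HB Require Import structures.
From mathcomp Require Import all_boot all_order all_algebra.
From mathcomp Require Import all_classical all_reals all_analysis.
From mathcomp Require Import ring lra.
Set Implicit Arguments.
Unset Strict Implicit.
Unset Printing Implicit Defensive.
Import Order.TTheory GRing.Theory Num.Theory.
Import numFieldNormedType.Exports.
Local Open Scope classical_set_scope.
Local Open Scope ring_scope.

(* An arrival distribution is any Borel probability on the real line; atoms and
   unbounded supports are allowed. *)
Definition arrival_distribution (R : realType) :=
  probability (measurableTypeR R) R.

(* F(t) is the proportion of drops that arrived strictly before t. *)
Definition arrived (R : realType) (P : arrival_distribution R) (t : R) : R :=
  fine (P `]-oo, t[%classic).

Definition served (R : realType) (Lambda : R) (P : arrival_distribution R)
    (Q : R -> R) (t : R) : R :=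
  Lambda * arrived P t - Q t.

(* [Q t] is the volume in the queue just before time [t], i.e. not counting the
   drops that arrive exactly at [t]. The bound [Q t <= Lambda * arrived P t]
   (only drops that have already arrived can be queueing) excludes a queue fed
   from minus infinity. *)
Record fluid_queue (R : realType) (Lambda mu : R) (P : arrival_distribution R)
    (Q : R -> R) : Prop := FluidQueue {
  queue_ge0 : forall t, 0 <= Q t ;
  queue_le_arrived : forall t, Q t <= Lambda * arrived P t ;
  served_nondecreasing : forall s t, s <= t ->
    served Lambda P Q s <= served Lambda P Q t ;
  served_rate_le : forall s t, s <= t ->
    served Lambda P Q t - served Lambda P Q s <= mu * (t - s) ;
  served_rate_busy : forall s t, s <= t ->
    (forall u, s < u < t -> 0 < Q u) ->
    served Lambda P Q t - served Lambda P Q s = mu * (t - s) }.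

(* Well defined by [fluid_queue_exists] and [fluid_queue_unique] below. *)
Definition queue (R : realType) (Lambda mu : R) (P : arrival_distribution R) :
    R -> R :=
  get [set Q | fluid_queue Lambda mu P Q].

Definition drop_cost (R : realType) (alpha beta1 beta2 t1 t2 : R) : R :=
  beta1 * Num.max (- t1) 0 + alpha * (t2 - t1) + beta2 * Num.max t2 0.

(* Drops arriving simultaneously are served in uniformly random order: a drop at
   relative rank [u] in [0, 1] within the atom at [t] finds [u] times the volume
   of that atom ahead of it, in addition to the earlier arrivals. When [t] is not
   an atom the waiting time does not depend on [u]. *)
Definition waiting_time (R : realType) (Lambda mu : R)
    (P : arrival_distribution R) (t u : R) : R :=
  (queue Lambda mu P t + u * (Lambda * fine (P [set t]))) / mu.

Definition social_cost (R : realType) (Lambda mu alpha beta1 beta2 : R)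
    (P : arrival_distribution R) : \bar R :=
  (Lambda%:E * \int[P]_t \int[lebesgue_measure]_(u in `[0%R, 1%R])
     (drop_cost alpha beta1 beta2 t (t + waiting_time Lambda mu P t u))%:E)%E.

Definition socially_optimal (R : realType) (Lambda mu alpha beta1 beta2 : R)
    (P : arrival_distribution R) : Prop :=
  forall P' : arrival_distribution R,
    (social_cost Lambda mu alpha beta1 beta2 P <=
     social_cost Lambda mu alpha beta1 beta2 P')%E.

(* Measures are functions on all sets; only their values on Borel sets matter. *)
Definition same_distribution (R : realType) (P P' : arrival_distribution R) :
    Prop :=
  forall A : set (measurableTypeR R), measurable A -> P A = P' A.

Definition has_density (R : realType) (P : arrival_distribution R)
    (f : R -> R) : Prop :=
  forall A : set (measurableTypeR R), measurable A ->
    P A = (\int[lebesgue_measure]_(x in A) (f x)%:E)%E.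

Section fluid_queue_facts.
Variables (R : realType) (Lambda mu : R) (P : arrival_distribution R).
Hypotheses (Lambda_gt0 : 0 < Lambda) (mu_gt0 : 0 < mu).

Let F := arrived P.

Lemma arrived_ge0 t : 0 <= F t.
Proof. by rewrite /F/arrived fine_ge0. Qed.

Lemma arrived_nondecreasing s t : s <= t -> F s <= F t.
Proof.
move=> st; rewrite /F/arrived fine_le ?fin_num_measure//.
by apply: le_measure; rewrite ?inE//; apply: subset_itvl; rewrite bnd_simp.
Qed.

Lemma arrived_left_continuous t e : 0 < e ->
  exists2 d, 0 < d & forall u, t - d < u -> F t - e < F u.
Proof.
move=> e0.
pose A n : set (measurableTypeR R) := `]-oo, t - n.+1%:R^-1[%classic.
have UA : \bigcup_n A n = `]-oo, t[%classic.
  apply/seteqP; split => x /=; rewrite ?in_itv/=.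
    move=> [n _]; rewrite /A/= in_itv/= => /lt_trans; apply.
    by rewrite ltrBlDr ltrDl invr_gt0.
  move=> xt.
  have tx : 0 < t - x by rewrite subr_gt0.
  have [n _ /(_ n (leqnn n)) /= H] := near_infty_natSinv_lt (PosNum tx).
  by exists n => //; rewrite /A/= in_itv/= ltrBrDl -ltrBrDr.
have : P \o A @ \oo --> P (\bigcup_n A n).
  apply: nondecreasing_cvg_mu => //.
  - by move=> n; exact: measurable_itv.
  - by apply: bigcup_measurable => n _; exact: measurable_itv.
  - move=> m n mn; apply/subsetPset; apply: subset_itvl; rewrite bnd_simp.
    by rewrite lerB// lef_pV2 ?posrE// ler_nat.
rewrite UA => PA.
have PA' : fine \o (P \o A) @ \oo --> fine (P `]-oo, t[%classic).
  by apply: fine_cvg; rewrite fineK ?fin_num_measure.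
have : \forall n \near \oo, fine (P `]-oo, t[%classic) - e < fine (P (A n)).
  by apply: (cvgr_gt _ PA'); rewrite ltrBlDr ltrDl.
move=> [n _ /(_ n (leqnn n)) /= Hn].
exists n.+1%:R^-1; first by rewrite invr_gt0.
move=> u tu; apply: (lt_le_trans Hn).
exact: (@arrived_nondecreasing (t - n.+1%:R^-1) u (ltW tu)).
Qed.

Lemma fluid_queue_unique Q1 Q2 :
  fluid_queue Lambda mu P Q1 -> fluid_queue Lambda mu P Q2 -> Q1 = Q2.
Proof.
suff le Q Q' : fluid_queue Lambda mu P Q -> fluid_queue Lambda mu P Q' ->
    forall t, Q t <= Q' t.
  by move=> h1 h2; apply/funext => t; apply/le_anti; rewrite !le.
move=> h h' t; rewrite leNgt; apply/negP => lt_t.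
have grow s : s <= t -> (forall u, s < u < t -> Q' u < Q u) ->
    Q t - Q' t <= Q s - Q' s.
  move=> st pos.
  have := served_rate_busy h st (fun u su => le_lt_trans (queue_ge0 h' u) (pos u su)).
  have := served_rate_le h' st.
  by rewrite /served; lra.
pose E := [set s | s <= t /\ Q s <= Q' s].
have ubE : ubound E t by move=> s [].
have [E0|/set0P E0] := eqVneq E set0.
  have pos u : u <= t -> Q' u < Q u.
    move=> ut; rewrite ltNge; apply/negP => QQ.
    by have : E u by []; rewrite E0.
  pose s := t - (served Lambda P Q t + 1) / mu.
  have S0 x : 0 <= served Lambda P Q x.
    by rewrite /served subr_ge0 (queue_le_arrived h).
  have st : s <= t.
    by rewrite lerBlDr lerDl divr_ge0 ?(ltW mu_gt0)// addr_ge0.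
  have := served_rate_busy h st.
  have -> : mu * (t - s) = served Lambda P Q t + 1.
    by rewrite /s; field; exact: lt0r_neq0.
  move=> H; have := S0 s; have := H _.
  suff : forall u, s < u < t -> 0 < Q u by move=> + K => /K; lra.
  move=> u /andP[_ /ltW ut]; exact: le_lt_trans (queue_ge0 h' u) (pos u ut).
have hsE : has_sup E by split=> //; exists t.
pose e := (Q t - Q' t) / (4 * mu).
have e0 : 0 < e by rewrite divr_gt0 ?subr_gt0// mulr_gt0.
have emu : mu * e = (Q t - Q' t) / 4.
  by rewrite /e; field; exact: lt0r_neq0.
have [a [at_ Ea] sa] := sup_adherent e0 hsE.
pose b := Num.min t (sup E + e).
have bt : b <= t by rewrite /b ge_min lexx.
have be : b <= sup E + e by rewrite /b ge_min lexx orbT.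
have aE : a <= sup E by apply: ub_le_sup => //; exists t.
have ab : a <= b by rewrite /b le_min at_/=; lra.
have Db : Q t - Q' t <= Q b - Q' b.
  apply: grow => // u /andP[bu ut]; rewrite ltNge; apply/negP => Qu.
  have uE : u <= sup E by apply: ub_le_sup; [exists t|split=> //; exact: ltW].
  by move: bu; rewrite /b gt_min => /orP[|]; lra.
have := served_rate_le h' ab.
have := served_nondecreasing h ab.
have : mu * (b - a) <= mu * (2 * e) by rewrite ler_pM2l//; lra.
by rewrite /served; lra.
Qed.

Lemma fluid_queue_exists : exists Q, fluid_queue Lambda mu P Q.
Proof.
pose g x := mu * x - Lambda * F x.
pose M t := sup [set g x | x in `]-oo, t]].
have LF x : 0 <= Lambda * F x by rewrite mulr_ge0 ?arrived_ge0// ltW.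
have ubg t : has_ubound [set g x | x in `]-oo, t]].
  exists (mu * t) => _ [x /= + <-]; rewrite in_itv/= => xt.
  by rewrite /g lerBlDr (le_trans (_ : _ <= mu * t)) ?ler_pM2l// lerDl.
have gM x t : x <= t -> g x <= M t.
  by move=> xt; apply: ub_le_sup => //; exists x => //=; rewrite in_itv.
have Mle t c : (forall x, x <= t -> g x <= c) -> M t <= c.
  move=> H; apply: ge_sup.
    by exists (g t), t => //=; rewrite in_itv/=.
  by move=> _ [x /= + <-]; rewrite in_itv/=; exact: H.
have Mnd s t : s <= t -> M s <= M t.
  by move=> st; apply: Mle => x xs; apply: gM; exact: le_trans st.
have Mlip s t : s <= t -> M t - M s <= mu * (t - s).
  move=> st; rewrite lerBlDr; apply: Mle => x xt.
  have [xs|sx] := leP x s.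
    by rewrite (le_trans (gM _ _ xs))// lerDr mulr_ge0 ?subr_ge0// ltW.
  have gs := gM s s (lexx _).
  have Fx : Lambda * F s <= Lambda * F x.
    by rewrite ler_pM2l// arrived_nondecreasing// ltW.
  have mx : mu * x <= mu * t by rewrite ler_pM2l.
  by move: gs; rewrite /g; lra.
pose Q t := M t - g t.
have SE t : served Lambda P Q t = mu * t - M t.
  by rewrite /served /Q /g -/F; lra.
exists Q; split.
- by move=> t; rewrite /Q subr_ge0 gM.
- move=> t; have : M t <= mu * t.
    apply: Mle => x xt; rewrite /g lerBlDr.
    by rewrite (le_trans (_ : _ <= mu * t)) ?ler_pM2l// lerDl.
  by rewrite /Q /g -/F; lra.
- by move=> s t /Mlip; rewrite !SE; lra.
- by move=> s t /Mnd; rewrite !SE; lra.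
move=> s t st pos; rewrite !SE.
suff : M t <= M s by have := Mnd _ _ st; lra.
rewrite leNgt; apply/negP => MM.
pose c := (M s + M t) / 2.
pose E := [set x | s <= x <= t /\ M x < c].
have Es : E s by rewrite /E/= lexx st; split=> //; rewrite /c; lra.
have ubE : ubound E t by move=> x [/andP[]].
have hsE : has_sup E by split; [exists s|exists t].
pose r := sup E.
have sr : s <= r by apply: ub_le_sup => //; exists t.
have rt : r <= t by apply: ge_sup => //; exists s.
have Mrc : M r <= c.
  apply/ler_addgt0Pr => e e0.
  have [|a Ea ra] := sup_adherent (_ : 0 < e / mu) hsE.
    exact: divr_gt0.
  have ar : a <= r by apply: ub_le_sup => //; exists t.
  have Ma := Ea.2.
  have := Mlip _ _ ar.
  have : mu * (r - a) <= mu * (e / mu) by rewrite ler_pM2l//; rewrite /r; lra.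
  have -> : mu * (e / mu) = e by field; exact: lt0r_neq0.
  lra.
have rt' : r < t.
  rewrite lt_neqAle rt andbT; apply/eqP => re; move: Mrc; rewrite re /c; lra.
have cMr : c <= M r.
  rewrite leNgt; apply/negP => Mr.
  pose d := (c - M r) / (2 * mu).
  have d0 : 0 < d by rewrite divr_gt0 ?subr_gt0// mulr_gt0.
  pose b := Num.min t (r + d).
  have rb : r < b by rewrite /b lt_min rt'/=; lra.
  have := Mlip _ _ (ltW rb).
  have : mu * (b - r) <= mu * d.
    by rewrite ler_pM2l// lerBlDl /b ge_min lexx orbT.
  have -> : mu * d = (c - M r) / 2 by rewrite /d; field; exact: lt0r_neq0.
  move=> H1 H2.
  have : E b.
    split; last by lra.
    by rewrite (le_trans sr (ltW rb))/= /b ge_min lexx.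
  move=> Eb; have : b <= r by apply: ub_le_sup => //; exists t.
  by rewrite leNgt rb.
have sr' : s < r.
  rewrite lt_neqAle sr andbT; apply/eqP => re; move: cMr; rewrite -re /c; lra.
have Qr : g r < c.
  have : 0 < Q r by apply: pos; rewrite sr'.
  by rewrite /Q; lra.
pose e := (c - g r) / 2.
have e0 : 0 < e by rewrite /e; lra.
have [d d0 Hd] := arrived_left_continuous r (divr_gt0 e0 Lambda_gt0).
have [a [_ Ma] ra] := sup_adherent d0 hsE.
suff : M r <= Num.max (M a) (g r + e).
  rewrite le_max => /orP[|]; first by lra.
  by rewrite /e; lra.
apply: Mle => x xr; rewrite le_max.
have [xa|ax] := leP x a; first by rewrite gM.
apply/orP; right.
have /Hd Fx : r - d < x by rewrite (lt_trans ra).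
have : Lambda * (F r - e / Lambda) <= Lambda * F x by rewrite ler_pM2l// ltW.
have -> : Lambda * (F r - e / Lambda) = Lambda * F r - e.
  by field; exact: lt0r_neq0.
have : mu * x <= mu * r by rewrite ler_pM2l.
by rewrite /g; lra.
Qed.

Lemma queueP : fluid_queue Lambda mu P (queue Lambda mu P).
Proof. by have [Q FQ] := fluid_queue_exists; exact: (getPex (ex_intro _ Q FQ)). Qed.

End fluid_queue_facts.

(* Main.v *)
Require Import Defs.
From HB Require Import structures.
From mathcomp Require Import all_boot all_order all_algebra.
From mathcomp Require Import all_classical all_reals all_analysis.
From mathcomp Require Import measurable_realfun ring lra.
Import Order.TTheory GRing.Theory Num.Theory.
Import numFieldNormedType.Exports.
Local Open Scope classical_set_scope.
Local Open Scope ring_scope.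

Set Implicit Arguments.
Unset Strict Implicit.
Unset Printing Implicit Defensive.

(** Let [D] be the service time of a random drop, where simultaneous arrivals are
    ranked by an independent uniform variable. Serving a drop at [D] after an
    arrival at [t <= D] costs at least [phi D + alpha * (D - t)], where
    [phi x = beta1 * max (- x) 0 + beta2 * max x 0] is the cost of being served
    at [x] without waiting: arriving earlier can only add earliness. So the
    problem reduces to the law of [D].

    The server works at rate at most [mu], so the law of [D] has density at most
    [mu / Lambda] ([departure_law_le]). The reason is that the rank of a random
    drop in the service order is uniform on [0, 1] ([rank_law], a probability
    integral transform that takes atoms into account), and that drops departing
    within a time [h] of each other have ranks within [mu / Lambda * h] of each
    other ([rank_le_departure]).

    Among the laws of density at most [mu / Lambda], the mean of [phi] is least
    when the mass fills the sublevel set of [phi] of Lebesgue measure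
    [Lambda / mu] (the bathtub principle, [cost_lower_bound]). This sublevel set
    is the interval of the statement, with level
    [L = beta1 * beta2 * Lambda / ((beta1 + beta2) * mu)], and the bound on the
    mean cost is [L / 2]. The uniform distribution on this interval creates no
    queue ([uniform_arrivals_queue]) and attains the bound
    ([uniform_arrivals_cost]). Conversely, equality forces [D = t] and
    [phi D <= L] almost surely, so that the arrival law itself has density at
    most [mu / Lambda] and lives on an interval of length [Lambda / mu]: it is
    uniform ([social_cost_le_uniform]). *)

(** * Comparison with Lebesgue measure *)

(** Lebesgue measure is the outer measure generated by the lengths of half-open
    intervals, so a bound on such intervals passes to countable covers and then
    to all Borel sets. *)
Lemma measure_le_lebesgue (R : realType)
    (nu : {measure set (measurableTypeR R) -> \bar R}) (c : R) : 0 < c ->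
  (forall x y, x < y -> (nu `]x, y]%classic <= (c * (y - x))%:E)%E) ->
  forall A, measurable A -> (nu A <= c%:E * lebesgue_measure A)%E.
Proof.
move=> c0 nuI A mA.
rewrite -lee_pdivrMl//.
apply: le_ereal_inf_tmp => _ [I [mI AI] <-].
rewrite lee_pdivrMl// -nneseriesZl//.
have mI' n : measurable (I n : set (measurableTypeR R)).
  exact: sub_sigma_algebra.
have subadd := measure_sigma_subadditive nu mI' mA AI.
apply: (le_trans subadd).
apply: lee_nneseries => // n _.
case: (mI n) => -[x y] _ /= <-.
have [xy|yx] := ltP x y.
  rewrite wlength_itv_bnd ?(ltW xy)// -EFinM; exact: nuI.
by rewrite set_itv_ge ?bnd_simp -?leNgt// wlength0 mule0 measure0.
Qed.

(** * The rank of a drop in the service order *)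

Section service_rank.
Context (R : realType) (P : arrival_distribution R).

(** The proportion of drops arriving exactly at [t]. *)
Definition atom (t : R) : R := fine (P [set t]).

Lemma atom_ge0 t : 0 <= atom t.
Proof. by rewrite /atom fine_ge0. Qed.

Lemma arrived_add_atom t : (arrived P t + atom t)%:E = P `]-oo, t]%classic.
Proof.
rewrite /arrived /atom EFinD !fineK ?fin_num_measure//.
rewrite -measureU//; last first.
  apply/seteqP; split => // x [/=]; rewrite in_itv/= => /[swap] ->.
  by rewrite ltxx.
by rewrite setUitv1.
Qed.

Lemma arrived_add_atom_le s t : s < t -> arrived P s + atom s <= arrived P t.
Proof.
move=> st; rewrite -lee_fin arrived_add_atom /arrived fineK ?fin_num_measure//.
by apply: le_measure; rewrite ?inE//; apply: subset_itvl; rewrite bnd_simp.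
Qed.

Lemma arrived_split s t : s <= t ->
  (arrived P t)%:E = ((arrived P s)%:E + P `[s, t[%classic)%E.
Proof.
move=> st; rewrite /arrived !fineK ?fin_num_measure//.
rewrite -measureU//; last first.
  apply/seteqP; split => // x [/=]; rewrite !in_itv/= => xs /andP[sx _].
  by move: xs; rewrite ltNge sx.
by rewrite -itv_bndbnd_setU// bnd_simp.
Qed.

(** The proportion of drops served before the drop that arrives at [z.1] and has
    relative position [z.2] among the simultaneous arrivals. *)
Definition service_rank (z : R * R) : R := arrived P z.1 + z.2 * atom z.1.

Lemma uniform01_itv (y : R) : 0 <= y <= 1 ->
  uniform_prob (@ltr01 R) `[0, y]%classic = y%:E.
Proof.
move=> /andP[y0 y1].
rewrite /uniform_prob (eq_integral (cst 1%:E)); last first.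
  move=> x; rewrite inE/= in_itv/= /uniform_pdf => /andP[x0 xy].
  by rewrite x0 (le_trans xy y1)/= subr0 invr1.
rewrite integral_cst//= mul1e lebesgue_measure_itv/= lte_fin.
by case: ltP => // y0'; rewrite ?oppr0 ?adde0//; congr EFin; apply/le_anti/andP.
Qed.

(** The law of the pair (arrival time, relative position) of a random drop: the
    position is uniform on [0, 1] and independent of the arrival time. *)
Definition drop_law : set (measurableTypeR R * measurableTypeR R) -> \bar R :=
  (P \x uniform_prob (@ltr01 R))%E.

HB.instance Definition _ := Measure.on drop_law.

(* The identity as a random variable, whose distribution function is
   [t |-> P ]-oo, t]]. *)
Let idR : measurableTypeR R -> R := idfun.

#[local] HB.instance Definition _ :=
  @isMeasurableFun.Build _ _ _ _ idR (@measurable_id _ _ setT).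

Let cdfE t : cdf (idR : {RV P >-> R}) t = (arrived P t + atom t)%:E.
Proof. by rewrite arrived_add_atom /cdf /distribution /pushforward /= preimage_id. Qed.

Lemma arrived_gt v : v < 1 -> exists t, v < arrived P t.
Proof.
move=> v1.
have /fine_cvgP[_] := @cvg_cdfy1 _ _ R P (idR : {RV P >-> R}).
move=> /cvgr_gt/(_ _ v1)[M [_ +]].
have M1 : M < M + 1 by rewrite ltrDl.
move=> /(_ _ M1) /=; rewrite cdfE /= => vM.
by exists (M + 1 + 1); rewrite (lt_le_trans vM)// arrived_add_atom_le// ltrDl.
Qed.

Lemma arrived_lt v : 0 < v -> exists t, arrived P t < v.
Proof.
move=> v0.
have /fine_cvgP[_] := @cvg_cdfNy0 _ _ R P (idR : {RV P >-> R}).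
move=> /cvgr_lt/(_ _ v0)[M [_ +]].
have M1 : M - 1 < M by rewrite ltrBlDr ltrDl.
move=> /(_ _ M1) /=; rewrite cdfE /= => vM.
by exists (M - 1); rewrite (le_lt_trans _ vM)// lerDl atom_ge0.
Qed.

Lemma arrived_right_limit v t : (forall s, t < s -> v < arrived P s) ->
  v <= arrived P t + atom t.
Proof.
move=> H.
have : (fine \o cdf (idR : {RV P >-> R})) x @[x --> t^'+] --> arrived P t + atom t.
  apply: fine_cvg; rewrite -cdfE; exact: cdf_right_continuous.
move=> /cvgr_to_ge; apply; near=> x.
rewrite /= cdfE /= (le_trans (ltW (H x _)))// lerDl atom_ge0//.
Unshelve. all: end_near. Qed.

(** A quantile [q] of level [v]: no drop arriving before [q] has rank above [v],
    and every drop arriving after [q] has rank above [v]. *)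
Lemma quantile_exists v : 0 < v < 1 -> exists q,
  [/\ forall s, s < q -> arrived P s + atom s <= v,
     forall s, q < s -> v < arrived P s &
     arrived P q <= v <= arrived P q + atom q].
Proof.
move=> /andP[v0 v1].
pose E := [set t | arrived P t <= v].
have [t0 t0v] := arrived_lt v0.
have [t1 t1v] := arrived_gt v1.
have ubE : ubound E t1.
  move=> t Et; rewrite leNgt; apply/negP => /ltW/(arrived_nondecreasing P).
  by move=> /(lt_le_trans t1v); rewrite ltNge => /negP; exact.
have hsE : has_sup E by split; [exists t0; exact: ltW | exists t1].
have ltE s : s < sup E -> arrived P s + atom s <= v.
  move=> sE; have e0 : 0 < sup E - s by rewrite subr_gt0.
  have [t Et st] := sup_adherent e0 hsE.
  apply: le_trans Et; apply: arrived_add_atom_le.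
  by move: st; rewrite opprB addrC subrK.
have gtE s : sup E < s -> v < arrived P s.
  move=> Es; rewrite ltNge; apply/negP => sE.
  have := ub_le_sup (ex_intro _ t1 ubE) sE.
  by rewrite leNgt Es.
exists (sup E); split => //; apply/andP; split; last exact: arrived_right_limit.
rewrite leNgt; apply/negP => vE.
have e0 : 0 < arrived P (sup E) - v by rewrite subr_gt0.
have [d d0 Hd] := arrived_left_continuous P (sup E) e0.
have [t Et st] := sup_adherent d0 hsE.
have := Hd _ st; rewrite opprB addrC subrK => /(le_lt_trans Et).
by rewrite ltxx.
Qed.

End service_rank.

Section rank_law.
Context (R : realType) (P : arrival_distribution R).

(** The pairs (arrival time, relative position) whose position is in [0, 1]. *)
Definition unit_strip : set (measurableTypeR R * measurableTypeR R) :=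
  setT `*` `[0, 1]%classic.

Lemma drop_lawX (A B : set (measurableTypeR R)) : measurable A -> measurable B ->
  drop_law P (A `*` B) = (P A * uniform_prob (@ltr01 R) B)%E.
Proof. exact: product_measure1E. Qed.

Lemma drop_lawT : drop_law P setT = 1%E.
Proof. by rewrite -setXTT drop_lawX// !probability_setT mule1. Qed.

Lemma drop_law_le1 A : measurable A -> (drop_law P A <= 1)%E.
Proof. by move=> mA; rewrite -drop_lawT le_measure ?inE. Qed.

(** The rank of a random drop is uniform on [0, 1]: with [q] the quantile of level
    [v], the event is made of the arrivals before [q] and of a share of the atom
    at [q]. *)
Lemma rank_law v : 0 < v < 1 ->
  drop_law P (unit_strip `&` [set z | service_rank P z <= v]) = v%:E.
Proof.
move=> v01; have [q [ltq gtq /andP[qv vq]]] := quantile_exists P v01.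
pose p := atom P q.
have p0 : 0 <= p by exact: atom_ge0.
(* [y] is the position inside the atom at [q] at which level [v] is reached. A null
   atom does not contribute, and [y = 1] then makes the set identity below hold. *)
pose y := if p == 0 then 1 else (v - arrived P q) / p.
have y01 : 0 <= y <= 1.
  rewrite /y; case: eqVneq => [|pN0]; first by rewrite ler01 lexx.
  have pgt0 : 0 < p by rewrite lt_neqAle eq_sym pN0.
  by rewrite divr_ge0 ?subr_ge0//= ler_pdivrMr// mul1r lerBlDl.
have yE : arrived P q + y * p = v.
  rewrite /y; case: eqVneq => [pE|pN0].
    by apply/le_anti; move: vq; rewrite -/p pE !(mulr0, addr0) => ->; rewrite qv.
  by rewrite divfK// addrC subrK.
have yP u : 0 <= u <= 1 -> (arrived P q + u * p <= v) = (u <= y).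
  move=> /andP[u0 u1]; rewrite -{1}yE lerD2l /y.
  case: eqVneq => [->|pN0]; first by rewrite !mulr0 lexx u1.
  by rewrite ler_pM2r// lt_neqAle eq_sym pN0.
have -> : unit_strip `&` [set z | service_rank P z <= v] =
    (`]-oo, q[%classic `*` `[0, 1]%classic) `|` ([set q] `*` `[0, y]%classic).
  apply/seteqP; split => -[t u] /=; rewrite /unit_strip/= !in_itv/=.
    move=> [[_ u01]]; rewrite /service_rank/=.
    have [tq|tq|->] := ltgtP t q; first by left.
      move=> tv; have := gtq _ tq; rewrite ltNge (le_trans _ tv)//.
      by rewrite lerDl mulr_ge0 ?atom_ge0//; case/andP: u01.
    by rewrite yP// => ->; right; case/andP: u01 => ->.
  move=> [[tq u01]|[-> /andP[u0 uy]]].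
    split => //; apply: le_trans (ltq _ tq); rewrite lerD2l ler_piMl ?atom_ge0//.
    by case/andP: u01.
  have u01 : 0 <= u <= 1 by rewrite u0 (le_trans uy)//; case/andP: y01.
  by split => //; rewrite /service_rank/= yP.
rewrite measureU; last 3 first.
- by apply: measurableX.
- by apply: measurableX.
- apply/seteqP; split => // -[t u] [[/= tq _] [/= tE _]].
  by move: tq; rewrite tE in_itv/= ltxx.
rewrite [X in (X + _)%E]drop_lawX// [X in (_ + X)%E]drop_lawX//.
rewrite !uniform01_itv ?lexx ?ler01// mule1.
have -> : P `]-oo, q[%classic = (arrived P q)%:E by rewrite fineK ?fin_num_measure.
have -> : P [set q] = p%:E by rewrite fineK ?fin_num_measure.
by rewrite -EFinM -EFinD mulrC yE.
Qed.

Lemma measurable_arrived : measurable_fun [set: measurableTypeR R] (arrived P).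
Proof. by apply: nondecreasing_measurable => // s t; exact: arrived_nondecreasing. Qed.

Lemma measurable_atom : measurable_fun [set: measurableTypeR R] (atom P).
Proof.
have -> : atom P = (fun t => (arrived P t + atom P t) - arrived P t).
  by apply/funext => t; rewrite addrAC subrr add0r.
apply: measurable_funB; last exact: measurable_arrived.
apply: nondecreasing_measurable => // s t; rewrite le_eqVlt => /predU1P[->//|st].
by rewrite (le_trans (arrived_add_atom_le P st))// lerDl atom_ge0.
Qed.

Lemma measurable_rank :
  measurable_fun [set: measurableTypeR R * measurableTypeR R] (service_rank P).
Proof.
apply: measurable_funD.
  by apply: measurableT_comp => //; exact: measurable_arrived.
apply: measurable_funM => //.
by apply: measurableT_comp => //; exact: measurable_atom.
Qed.

(** Unlike in [rank_law], the bounds [v] and [w] are not restricted to [0, 1]. *)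
Lemma rank_window (v w : R) : v < w ->
  (drop_law P (unit_strip `&` service_rank P @^-1` `]v, w]%classic) <= (w - v)%:E)%E.
Proof.
move=> vw.
pose G x := unit_strip `&` [set z | service_rank P z <= x].
have mG x : measurable (G x).
  apply: measurableI; first exact: measurableX.
  have -> : [set z | service_rank P z <= x] = service_rank P @^-1` `]-oo, x]%classic.
    by apply/seteqP; split => z /=; rewrite in_itv.
  by rewrite -[X in measurable X]setTI; apply: measurable_rank => //.
have Gle x : 0 < x -> (drop_law P (G x) <= x%:E)%E.
  move=> x0; have [x1|x1] := ltP x 1; first by rewrite rank_law// x0.
  by rewrite (le_trans (drop_law_le1 (mG x))).
have rank01 z : unit_strip z -> 0 <= service_rank P z <= 1.
  case: z => t u [_ /=]; rewrite in_itv/= => /andP[u0 u1].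
  rewrite /service_rank/= addr_ge0 ?arrived_ge0 ?mulr_ge0 ?atom_ge0//=.
  rewrite -lee_fin (@le_trans _ _ (P `]-oo, t]%classic)) ?probability_le1//.
  by rewrite -arrived_add_atom lee_fin lerD2l ler_piMl ?atom_ge0.
have [v0|v0] := leP v 0.
  apply: le_trans (Gle _ _); last by rewrite subr_gt0.
  apply: le_measure; rewrite ?inE//; last first.
    move=> z [sz /=]; rewrite in_itv/= => /andP[_ zw]; split => //=.
    by rewrite (le_trans zw)// lerDl oppr_ge0.
  apply: measurableI; first exact: measurableX.
  by rewrite -[X in measurable X]setTI; apply: measurable_rank => //.
have GD : unit_strip `&` service_rank P @^-1` `]v, w]%classic = G w `\` G v.
  apply/seteqP; split => z /=; rewrite in_itv/=.
    by move=> [sz /andP[vz zw]]; split => // -[_] /=; rewrite leNgt vz.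
  move=> [[sz /= zw] nv]; split => //; rewrite zw andbT ltNge.
  by apply/negP => zv; apply: nv.
have sG : G v `<=` G w by move=> z [sz /= zv]; split => //=; rewrite (le_trans zv)// ltW.
have [v1|v1] := leP 1 v.
  rewrite (_ : _ `&` _ = set0) ?measure0 ?lee_fin ?subr_ge0 ?ltW//.
  apply/seteqP; split => // z [/rank01/andP[_ z1] /=]; rewrite in_itv/= => /andP[+ _].
  by rewrite ltNge (le_trans z1).
have mv : drop_law P (G v) = v%:E by rewrite rank_law// v0.
rewrite GD EFinB leeBrDr// -mv -measureU.
- by rewrite setUC setDUK// Gle// (lt_trans v0).
- exact: measurableD.
- exact: mG.
- by apply/seteqP; split => // z [[_ nGz]].
Qed.

End rank_law.
Arguments unit_strip : clear implicits.

(** * The law of the departure time *)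

Section departure.
Context (R : realType) (Lambda mu : R) (P : arrival_distribution R).
Hypotheses (Lambda_gt0 : 0 < Lambda) (mu_gt0 : 0 < mu).

Let Q := queue Lambda mu P.
Let QP : fluid_queue Lambda mu P Q.
Proof. exact: queueP. Qed.

(** The cumulative unused capacity of the server, up to an additive constant:
    capacity minus served volume. *)
Definition idle (t : R) : R := mu * t - served Lambda P (queue Lambda mu P) t.

Lemma idle_nondecreasing s t : s <= t -> idle s <= idle t.
Proof. by move=> st; have := served_rate_le QP st; rewrite /idle -/Q; lra. Qed.

(** The time at which the drop with arrival time and relative position [z] is
    served. *)
Definition departure (z : R * R) : R := z.1 + waiting_time Lambda mu P z.1 z.2.

(** The capacity offered up to the departure of a drop is the unused one before
    its arrival plus the volume served up to and including that drop. *)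
Lemma departureE z : mu * departure z = idle z.1 + Lambda * service_rank P z.
Proof.
rewrite /departure /waiting_time /idle /served /service_rank /atom -/Q.
by field; rewrite gt_eqF.
Qed.

Lemma waiting_time_ge0 z : unit_strip R z -> 0 <= waiting_time Lambda mu P z.1 z.2.
Proof.
move=> [_ /=]; rewrite in_itv/= => /andP[u0 _].
rewrite divr_ge0 ?(ltW mu_gt0)// addr_ge0 ?(queue_ge0 QP)//.
by rewrite mulr_ge0// mulr_ge0 ?(ltW Lambda_gt0)// fine_ge0.
Qed.

Lemma measurable_departure :
  measurable_fun [set: measurableTypeR R * measurableTypeR R]
    (departure : _ -> measurableTypeR R).
Proof.
have -> : departure = fun z => mu^-1 * (idle z.1 + Lambda * service_rank P z).
  by apply/funext => z; rewrite -departureE mulKf// gt_eqF.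
apply: measurable_funM => //; apply: measurable_funD; last first.
  by apply: measurable_funM => //; exact: measurable_rank.
apply: (@measurableT_comp _ _ _ _ _ _ idle) => //.
by apply: nondecreasing_measurable => // s t; exact: idle_nondecreasing.
Qed.

Lemma rank_le_of_lt z z' : unit_strip R z -> z.1 < z'.1 -> unit_strip R z' ->
  service_rank P z <= service_rank P z'.
Proof.
case: z z' => [t u] [t' u'] [_ /=]; rewrite in_itv/= => /andP[u0 u1] tt'.
move=> [_ /=]; rewrite in_itv/= => /andP[u'0 u'1].
rewrite /service_rank/=; apply: (@le_trans _ _ (arrived P t + atom P t)).
  by rewrite lerD2l ler_piMl ?atom_ge0.
by rewrite (le_trans (arrived_add_atom_le P tt'))// lerDl mulr_ge0 ?atom_ge0.
Qed.

(** First-come-first-served: between two drops, the server must serve the volume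
    that separates their ranks, and it does so at rate at most [mu]. *)
Lemma rank_le_departure z z' : unit_strip R z -> unit_strip R z' ->
  service_rank P z' < service_rank P z ->
  Lambda * (service_rank P z - service_rank P z') <= mu * (departure z - departure z').
Proof.
move=> sz sz' rlt.
have zz' : z'.1 <= z.1.
  rewrite leNgt; apply/negP => /(rank_le_of_lt sz)/(_ sz').
  by rewrite leNgt rlt.
by have := idle_nondecreasing zz'; rewrite !mulrBr !departureE; lra.
Qed.

(** The position is almost surely in [0, 1]. *)
Lemma drop_law_strip (A : set (measurableTypeR R * measurableTypeR R)) :
  measurable A -> drop_law P A = drop_law P (unit_strip R `&` A).
Proof.
move=> mA.
have mS : measurable (unit_strip R) by apply: measurableX.
rewrite (measureDI (drop_law P) mA mS) [X in (X + _)%E](_ : _ = 0%E).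
  by rewrite add0e setIC.
apply/eqP; rewrite -measure_le0.
have <- : drop_law P (~` unit_strip R) = 0%E.
  have := drop_lawT P.
  rewrite -(setvU (unit_strip R)) measureU//.
  - rewrite [X in (_ + X)%E]drop_lawX// probability_setT mul1e.
    rewrite uniform01_itv ?lexx ?ler01// => H.
    have : (drop_law P (~` unit_strip R) + 1 - 1 = 0)%E by rewrite H subee.
    by rewrite addeK.
  - exact: measurableC.
  - by rewrite setICl.
apply: le_measure; rewrite ?inE; [exact: measurableD|exact: measurableC|].
by move=> z [].
Qed.

(** The ranks of the drops departing between [x] and [y] differ by at most
    [mu / Lambda * (y - x)], and ranks are uniformly distributed. *)
Lemma departure_window (x y : R) : x < y ->
  (drop_law P (departure @^-1` `]x, y]%classic) <= (mu / Lambda * (y - x))%:E)%E.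
Proof.
move=> xy; have mE : measurable (departure @^-1` `]x, y]%classic).
  by rewrite -[X in measurable X]setTI; apply: measurable_departure => //.
rewrite drop_law_strip//; set E := _ `&` _.
have mE' : measurable E by apply: measurableI => //; exact: measurableX.
pose l := mu / Lambda * (y - x).
have l0 : 0 < l by rewrite mulr_gt0 ?divr_gt0 ?subr_gt0.
have [->|/set0P[z0 Ez0]] := eqVneq E set0; first by rewrite measure0 lee_fin ltW.
have spread z z' : E z -> E z' -> service_rank P z <= service_rank P z' + l.
  move=> [sz /=]; rewrite in_itv/= => /andP[_ zy].
  move=> [sz' /=]; rewrite in_itv/= => /andP[xz' _].
  have [zz'|z'z] := leP (service_rank P z) (service_rank P z').
    by rewrite (le_trans zz')// lerDl ltW.
  rewrite -lerBlDl -(ler_pM2l Lambda_gt0).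
  apply: (le_trans (rank_le_departure sz sz' z'z)).
  rewrite /l mulrA [Lambda * _]mulrC divfK ?gt_eqF// ler_pM2l//.
  by rewrite lerB// ltW.
apply/lee_addgt0Pr => e e0.
(* The infimum need not be attained, hence the margin [e] below it. *)
pose v0 := inf [set service_rank P z | z in E].
have lbv : lbound [set service_rank P z | z in E] (service_rank P z0 - l).
  by move=> _ [z Ez <-]; rewrite lerBlDr spread.
have neE : [set service_rank P z | z in E] !=set0 by exists (service_rank P z0), z0.
have v0E z : E z -> v0 - e < service_rank P z <= v0 + l.
  move=> Ez; apply/andP; split.
    rewrite (@lt_le_trans _ _ v0) ?ltrBlDr ?ltrDl//.
    by apply: ge_inf; [exists (service_rank P z0 - l) | exists z].
  rewrite -lerBlDr; apply: lb_le_inf => // _ [z' Ez' <-].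
  by rewrite lerBlDr spread.
apply: (@le_trans _ _ (v0 + l - (v0 - e))%:E); last first.
  by rewrite -EFinD lee_fin /l; lra.
have vw : v0 - e < v0 + l by lra.
apply: le_trans (rank_window P vw).
apply: le_measure; rewrite ?inE//.
  apply: measurableI; first exact: measurableX.
  by rewrite -[X in measurable X]setTI; apply: measurable_rank => //.
by move=> z Ez; split; [case: Ez|rewrite /= in_itv/=; exact: v0E].
Qed.

Let departure_law : {measure set (measurableTypeR R) -> \bar R} :=
  measure_function_pushforward__canonical__measure_function_Measure
    (drop_law P) measurable_departure.

(** The law of the departure time has density at most [mu / Lambda]. *)
Lemma departure_law_le A : measurable A ->
  (drop_law P (departure @^-1` A) <= (mu / Lambda)%:E * lebesgue_measure A)%E.
Proof.
apply: (measure_le_lebesgue (nu := departure_law)); first by rewrite divr_gt0.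
exact: departure_window.
Qed.

Lemma integral_departure_le (h : measurableTypeR R -> \bar R) :
  measurable_fun setT h -> (forall x, 0 <= h x)%E ->
  (\int[drop_law P]_z h (departure z) <=
   (mu / Lambda)%:E * \int[lebesgue_measure]_x h x)%E.
Proof.
move=> mh h0.
have c0 : 0 <= mu / Lambda by rewrite divr_ge0 ?ltW.
have -> : (\int[drop_law P]_z h (departure z) = \int[departure_law]_x h x)%E.
  by rewrite (ge0_integral_pushforward measurable_departure).
apply: (@le_trans _ _ (\int[mscale (NngNum c0) lebesgue_measure]_x h x))%E; last first.
  by rewrite ge0_integral_mscale.
by apply: ge0_le_measure_integral => // A mA; exact: departure_law_le.
Qed.

End departure.

(** * Lower bound on the cost *)

Section cost_bound.
Context (R : realType) (Lambda mu alpha beta1 beta2 : R) (P : arrival_distribution R).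
Hypotheses (Lambda_gt0 : 0 < Lambda) (mu_gt0 : 0 < mu) (alpha_gt0 : 0 < alpha).
Hypotheses (beta1_gt0 : 0 < beta1) (beta2_gt0 : 0 < beta2).

(** The cost of a drop that arrives at [x] and is served without waiting. *)
Definition deviation_cost (x : R) : R :=
  beta1 * Num.max (- x) 0 + beta2 * Num.max x 0.

Lemma deviation_cost_ge0 x : 0 <= deviation_cost x.
Proof.
by rewrite addr_ge0// mulr_ge0 ?(ltW beta1_gt0) ?(ltW beta2_gt0)// le_max lexx orbT.
Qed.

Lemma measurable_deviation_cost : measurable_fun [set: measurableTypeR R] deviation_cost.
Proof.
apply: measurable_funD; apply: measurable_funM => //; apply: measurable_maxr => //.
Qed.

(** Postponing the arrival of a drop to its service time saves the waiting cost
    and does not increase the earliness cost. *)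
Lemma deviation_cost_le (t1 t2 : R) : t1 <= t2 ->
  deviation_cost t2 + alpha * (t2 - t1) <= drop_cost alpha beta1 beta2 t1 t2.
Proof.
move=> t12; rewrite /deviation_cost /drop_cost addrAC lerD2r lerD2r.
rewrite ler_pM2l// ge_max !le_max lexx orbT andbT.
by rewrite lerN2 t12.
Qed.

Let dep := departure Lambda mu P.
Let cost (z : R * R) : R := drop_cost alpha beta1 beta2 z.1 (dep z).

Let measurable_dep : measurable_fun [set: measurableTypeR R * measurableTypeR R] dep.
Proof. exact: measurable_departure. Qed.

Lemma measurable_cost : measurable_fun [set: measurableTypeR R * measurableTypeR R] cost.
Proof.
apply: measurable_funD; last first.
  by apply: measurable_funM => //; apply: measurable_maxr.
apply: measurable_funD; apply: measurable_funM => //.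
  by apply: measurable_maxr => //; apply: measurableT_comp.
exact: measurable_funB.
Qed.

Lemma arrival_le_departure z : unit_strip R z -> z.1 <= dep z.
Proof. by move=> sz; rewrite /dep /departure lerDl waiting_time_ge0. Qed.

Lemma cost_ge0 z : unit_strip R z -> 0 <= cost z.
Proof.
move=> sz; have zd := arrival_le_departure sz.
apply: le_trans (deviation_cost_le zd).
by rewrite addr_ge0 ?deviation_cost_ge0// mulr_ge0 ?subr_ge0// ltW.
Qed.

Let measurable_strip : measurable (unit_strip R).
Proof. exact: measurableX. Qed.

Lemma social_costE : social_cost Lambda mu alpha beta1 beta2 P =
  (Lambda%:E * \int[drop_law P]_(z in unit_strip R) (cost z)%:E)%E.
Proof.
rewrite /social_cost; congr (_ * _)%E.
rewrite [RHS]integral_mkcond.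
pose g := (fun z => (cost z)%:E) \_ (unit_strip R).
have mg : measurable_fun setT g.
  apply/(measurable_restrictT _ _).1 => //.
  by apply/measurable_EFinP/measurable_funTS; exact: measurable_cost.
have g0 z : (0 <= g z)%E.
  rewrite /g patchE; case: ifPn => // /set_mem sz.
  by rewrite lee_fin cost_ge0.
rewrite -/g /drop_law (@fubini_tonelli1 _ _ _ _ _ P (uniform_prob (@ltr01 R)) g mg g0).
apply: eq_integral => t _; rewrite /fubini_F.
rewrite integral_uniform; last 2 first.
- exact: (measurableT_comp mg (measurable_pair1 t)).
- by move=> u; exact: g0.
rewrite subr0 invr1 mul1e; apply: eq_integral => u u01.
rewrite /g patchE ifT//; apply/mem_set; split => //; exact/set_mem.
Qed.

(** The bathtub bound with level [L], written with nonnegative integrands only.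
    With [D] the departure time and [phi] the deviation cost, it rests on
    [phi D + max (L - phi D) 0 = L + max (phi D - L) 0] and on the density bound
    for [D]. The integral on the left is the excess cost: it vanishes only if
    almost all drops depart on arrival at a time where [phi] is at most [L]. *)
Lemma cost_lower_bound (L : R) : 0 <= L ->
  (L%:E + \int[drop_law P]_(z in unit_strip R)
     (alpha * (dep z - z.1) + Num.max (deviation_cost (dep z) - L) 0)%:E <=
   \int[drop_law P]_(z in unit_strip R) (cost z)%:E +
   (mu / Lambda)%:E *
     \int[lebesgue_measure]_x (Num.max (L - deviation_cost x) 0)%:E)%E.
Proof.
move=> L0.
have mh : measurable_fun [set: measurableTypeR R]
    (fun x => (Num.max (L - deviation_cost x) 0)%:E).
  apply/measurable_EFinP; apply: measurable_maxr => //.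
  by apply: measurable_funB => //; exact: measurable_deviation_cost.
have mhd := measurableT_comp mh measurable_dep.
have <- : (\int[drop_law P]_(z in unit_strip R) L%:E = L%:E)%E.
  rewrite integral_cst//= -[in X in (_ * X)%E](setIT (unit_strip R)).
  by rewrite -drop_law_strip// drop_lawT mule1.
have r0 z : unit_strip R z ->
    0 <= alpha * (dep z - z.1) + Num.max (deviation_cost (dep z) - L) 0.
  move=> sz; rewrite addr_ge0 ?le_max ?lexx ?orbT//.
  by rewrite mulr_ge0 ?(ltW alpha_gt0)// subr_ge0 arrival_le_departure.
have mr : measurable_fun [set: measurableTypeR R * measurableTypeR R]
    (fun z => alpha * (dep z - z.1) + Num.max (deviation_cost (dep z) - L) 0).
  apply: measurable_funD; first by apply: measurable_funM => //; exact: measurable_funB.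
  apply: measurable_maxr => //; apply: measurable_funB => //.
  exact: (measurableT_comp measurable_deviation_cost measurable_dep).
rewrite -ge0_integralD//; last first.
  by apply/measurable_EFinP/measurable_funTS.
apply: (@le_trans _ _ (\int[drop_law P]_(z in unit_strip R)
   ((cost z)%:E + (Num.max (L - deviation_cost (dep z)) 0)%:E))%E).
  apply: ge0_le_integral => //.
  - by move=> z sz; rewrite -EFinD lee_fin addr_ge0// r0.
  - by apply/measurable_EFinP/measurable_funTS; apply: measurable_funD.
  - apply: emeasurable_funD; last exact: measurable_funTS.
    by apply/measurable_EFinP/measurable_funTS; exact: measurable_cost.
  move=> z sz; rewrite -!EFinD lee_fin.
  have := deviation_cost_le (arrival_le_departure sz); rewrite -/(cost z).
  have [LD|DL] := leP (deviation_cost (dep z)) L.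
    rewrite max_r ?subr_le0// max_l ?subr_ge0//; lra.
  rewrite max_l ?subr_ge0 ?(ltW DL)// max_r ?subr_le0 ?(ltW DL)//; lra.
rewrite ge0_integralD//; last 4 first.
- by move=> z sz; rewrite lee_fin cost_ge0.
- by apply/measurable_EFinP/measurable_funTS; exact: measurable_cost.
- by move=> z _; rewrite lee_fin le_max lexx orbT.
- exact: measurable_funTS.
apply: leeD => //.
have h0 x : (0 <= (Num.max (L - deviation_cost x) 0)%:E)%E.
  by rewrite lee_fin le_max lexx orbT.
apply: (le_trans _ (integral_departure_le P Lambda_gt0 mu_gt0 mh h0)).
exact: ge0_subset_integral.
Qed.

End cost_bound.

(** * Integrals of the deviation cost *)

Section triangle.
Context (R : realType).

Lemma integral_linear (k x y : R) : x < y ->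
  (\int[lebesgue_measure]_(t in `[x, y]) (k * t)%:E =
   (k / 2 * (y ^+ 2 - x ^+ 2))%:E)%E.
Proof.
move=> xy; pose F (t : R) : R := k / 2 * t ^+ 2.
have cF : continuous F.
  move=> t; apply: cvgM; first exact: cvg_cst.
  exact: exprn_continuous.
rewrite (@continuous_FTC2 _ _ F)//.
- by rewrite -EFinB /F -mulrBr.
- apply: continuous_subspaceT => t; apply: cvgM; first exact: cvg_cst.
  exact: cvg_id.
- split.
  + by move=> t _; apply: ex_derive.
  + exact/cvg_at_right_filter/cF.
  + exact/cvg_at_left_filter/cF.
- move=> t _; rewrite derive1E derive_val.
  (* The derivative is expressed by scaling in [R] as a module over itself. *)
  change (k / 2 * (t * 1 + t * 1) = k * t); rewrite mulr1.
  by field.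
Qed.

Context (beta1 beta2 a b : R).
Hypotheses (beta1_gt0 : 0 < beta1) (beta2_gt0 : 0 < beta2) (a_gt0 : 0 < a) (b_gt0 : 0 < b).

Let phi := deviation_cost beta1 beta2.

Let mphi : measurable_fun [set: measurableTypeR R] (fun x => (phi x)%:E).
Proof. by apply/measurable_EFinP; exact: measurable_deviation_cost. Qed.

Lemma integral_deviation_cost :
  (\int[lebesgue_measure]_(x in `[(- a)%R, b]) (phi x)%:E =
   ((beta1 * a ^+ 2 + beta2 * b ^+ 2) / 2)%:E)%E.
Proof.
have -> : `[- a, b]%classic = `[- a, 0]%classic `|` `]0, b]%classic :> set R.
  apply/seteqP; split => x /=; rewrite !in_itv/=.
    by have [x0|x0] := leP x 0 => /andP[-> ->]; [left|right].
  move=> [/andP[-> x0]|/andP[x0 ->]]; first by rewrite (le_trans x0) ?ltW.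
  by rewrite andbT (le_trans _ (ltW x0))// oppr_le0 ltW.
rewrite ge0_integral_setU//=; last 3 first.
- exact: measurable_funTS.
- by move=> x _; rewrite lee_fin deviation_cost_ge0.
- apply/disj_setPS => x [/=]; rewrite !in_itv/= => /andP[_ x0] /andP[].
  by rewrite ltNge x0.
rewrite integral_itv_obnd_cbnd; last exact: measurable_funTS.
rewrite [X in (X + _)%E](_ : _ =
    \int[lebesgue_measure]_(x in `[(- a)%R, 0%R]) (- beta1 * x)%:E)%E; last first.
  apply: eq_integral => x; rewrite inE/= in_itv/= => /andP[_ x0].
  by rewrite /phi /deviation_cost max_l ?oppr_ge0// max_r// mulr0 addr0 mulrN mulNr.
rewrite [X in (_ + X)%E](_ : _ =
    \int[lebesgue_measure]_(x in `[0%R, b]) (beta2 * x)%:E)%E; last first.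
  apply: eq_integral => x; rewrite inE/= in_itv/= => /andP[x0 _].
  by rewrite /phi /deviation_cost max_r ?oppr_le0// max_l// mulr0 add0r.
rewrite !integral_linear ?oppr_lt0// -EFinD; congr EFin.
by field.
Qed.

Lemma deviation_cost_le_level (L x : R) : L = beta1 * a -> L = beta2 * b ->
  (phi x <= L) = (x \in `[- a, b]).
Proof.
move=> L1 L2; rewrite in_itv/= /phi /deviation_cost; have [x0|x0] := leP 0 x.
  rewrite max_r ?oppr_le0// mulr0 add0r L2 ler_pM2l//.
  by rewrite [- a <= x](le_trans _ x0)// oppr_le0 ltW.
rewrite max_l ?oppr_ge0 ?(ltW x0)// mulr0 addr0 L1 ler_pM2l// lerNl.
by rewrite [x <= b](le_trans (ltW x0) (ltW b_gt0)) andbT.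
Qed.

(** The area between the level [L] and the graph of the deviation cost is that of
    a triangle of height [L] with base from [- a] to [b]. *)
Lemma integral_level_complement (L : R) : L = beta1 * a -> L = beta2 * b ->
  (\int[lebesgue_measure]_x (Num.max (L - phi x) 0)%:E =
   (L * (a + b) / 2)%:E)%E.
Proof.
move=> L1 L2.
have JE := deviation_cost_le_level _ L1 L2.
have mh : measurable_fun [set: measurableTypeR R]
    (fun x => (Num.max (L - phi x) 0)%:E).
  apply/measurable_EFinP; apply: measurable_maxr => //.
  by apply: measurable_funB => //; exact: measurable_deviation_cost.
have h0 x : (0 <= (Num.max (L - phi x) 0)%:E)%E.
  by rewrite lee_fin le_max lexx orbT.
have -> : (\int[lebesgue_measure]_x (Num.max (L - phi x) 0)%:E =
  \int[lebesgue_measure]_(x in `[(- a)%R, b]) (Num.max (L - phi x) 0)%:E)%E.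
  rewrite [RHS]integral_mkcond; apply: eq_integral => x _.
  rewrite patchE; case: ifPn => //; rewrite notin_setE /= -JE => /negP.
  by rewrite -ltNge => Lx; rewrite max_r// subr_le0 ltW.
have : (\int[lebesgue_measure]_(x in `[(- a)%R, b]) L%:E = (L * (b + a))%:E)%E.
  rewrite integral_cst//= lebesgue_measure_itv/= lte_fin.
  by rewrite (lt_trans _ b_gt0) ?oppr_lt0// opprK.
have -> : (\int[lebesgue_measure]_(x in `[(- a)%R, b]) L%:E =
  \int[lebesgue_measure]_(x in `[(- a)%R, b])
    ((Num.max (L - phi x) 0)%:E + (phi x)%:E))%E.
  apply: eq_integral => x; rewrite inE/= -JE => xL.
  by rewrite max_l ?subr_ge0// -EFinD subrK.
rewrite ge0_integralD//; last 3 first.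
- exact: measurable_funTS.
- by move=> x _; rewrite lee_fin deviation_cost_ge0.
- exact: measurable_funTS.
rewrite integral_deviation_cost.
have -> : (beta1 * a ^+ 2 + beta2 * b ^+ 2) / 2 = L * (a + b) / 2.
  by rewrite !expr2 !mulrA -L1 -L2 mulrDr.
move=> H; rewrite -[LHS](@addeK _ (L * (a + b) / 2)%:E)// H -EFinB.
by congr EFin; field.
Qed.

End triangle.

(** * Optimality and uniqueness of the uniform distribution *)

Section optimum.
Context (R : realType) (Lambda mu alpha beta1 beta2 : R).
Hypotheses (Lambda_gt0 : 0 < Lambda) (mu_gt0 : 0 < mu) (alpha_gt0 : 0 < alpha).
Hypotheses (beta1_gt0 : 0 < beta1) (beta2_gt0 : 0 < beta2).

(* [- a] and [b] are the endpoints of the optimal interval, whose length is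
   [Lambda / mu], and [L] is the common deviation cost at both endpoints. *)
Let a := beta2 * Lambda / ((beta1 + beta2) * mu).
Let b := beta1 * Lambda / ((beta1 + beta2) * mu).
Let L := beta1 * a.

Let beta_gt0 : 0 < beta1 + beta2. Proof. exact: addr_gt0. Qed.
Let a_gt0 : 0 < a. Proof. by rewrite divr_gt0 ?mulr_gt0. Qed.
Let b_gt0 : 0 < b. Proof. by rewrite divr_gt0 ?mulr_gt0. Qed.
Let L_gt0 : 0 < L. Proof. by rewrite mulr_gt0. Qed.
Let L_beta2 : L = beta2 * b.
Proof. by rewrite /L /a /b; field; rewrite !gt_eqF. Qed.
Let rate_width : mu / Lambda * (a + b) = 1.
Proof. by rewrite /a /b; field; rewrite !gt_eqF. Qed.
Let inv_width : (b - - a)^-1 = mu / Lambda.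
Proof.
have -> : b - - a = Lambda / mu by rewrite /a /b; field; rewrite !gt_eqF.
by rewrite invf_div.
Qed.

Let ab : - a < b.
Proof. by rewrite (lt_trans _ b_gt0)// oppr_lt0. Qed.

(** The uniform distribution between [- a] and [b]. *)
Definition uniform_arrivals : arrival_distribution R := uniform_prob ab.

Lemma uniform_arrivalsE (A : set (measurableTypeR R)) : measurable A ->
  uniform_arrivals A =
    ((mu / Lambda)%:E * lebesgue_measure (A `&` `[(- a)%R, b]%classic))%E.
Proof.
move=> mA; rewrite /uniform_arrivals/= /uniform_prob integral_uniform_pdf.
rewrite (eq_integral (cst (mu / Lambda)%:E)); last first.
  by move=> x; rewrite inE/= in_itv/= /uniform_pdf => -[_ ->]; rewrite inv_width.
by rewrite integral_cst//; exact: measurableI.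
Qed.

Lemma uniform_arrivals_le (A : set (measurableTypeR R)) : measurable A ->
  (uniform_arrivals A <= (mu / Lambda)%:E * lebesgue_measure A)%E.
Proof.
have c0 : 0 <= mu / Lambda by rewrite divr_ge0 ?ltW.
move=> mA; rewrite uniform_arrivalsE//.
apply: lee_wpmul2l; first by rewrite lee_fin.
by apply: le_measure; rewrite ?inE//; exact: measurableI.
Qed.

Lemma uniform_arrivals_density : has_density uniform_arrivals
  (fun t => mu / Lambda * \1_`[- a, b] t).
Proof.
move=> A mA; rewrite /uniform_arrivals/= /uniform_prob.
apply: eq_integral => x _; rewrite /uniform_pdf inv_width indicE.
by rewrite mem_setE in_itv/=; case: ifPn; rewrite ?mulr1 ?mulr0.
Qed.

(** Drops arrive at rate [mu] at most, so the empty queue satisfies the queue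
    equations, which have only one solution. *)
Lemma uniform_arrivals_queue : queue Lambda mu uniform_arrivals = cst 0.
Proof.
apply: (@fluid_queue_unique _ Lambda mu uniform_arrivals) => //.
  exact: queueP.
have inc s t : s <= t -> arrived uniform_arrivals t - arrived uniform_arrivals s <=
    mu / Lambda * (t - s).
  move=> st; rewrite lerBlDl -lee_fin.
  rewrite (arrived_split _ st).
  rewrite EFinD leeD2l//; apply: le_trans (uniform_arrivals_le _) _ => //.
  rewrite lebesgue_measure_itv/= lte_fin; case: ltP => _.
    by rewrite -EFinB -EFinM.
  by rewrite mule0 lee_fin mulr_ge0 ?subr_ge0// divr_ge0 ?ltW.
split => //.
- by move=> t; rewrite mulr_ge0 ?arrived_ge0 ?ltW.
- by move=> s t st; rewrite /served !subr0 ler_pM2l// arrived_nondecreasing.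
- move=> s t st; rewrite /served !subr0 -mulrBr -ler_pdivlMl//.
  by rewrite mulrA [_^-1 * _]mulrC inc.
- move=> s t; rewrite le_eqVlt => /predU1P[->|st pos]; first by rewrite !subrr mulr0.
  by have := pos ((s + t) / 2); rewrite !midf_lt// ltxx => /(_ isT).
Qed.

Lemma uniform_arrivals_cost : social_cost Lambda mu alpha beta1 beta2 uniform_arrivals =
  (Lambda * (L / 2))%:E.
Proof.
rewrite /social_cost EFinM; congr (_ * _)%E.
have w0 t u : waiting_time Lambda mu uniform_arrivals t u = 0.
  rewrite /waiting_time uniform_arrivals_queue.
  have -> : uniform_arrivals [set t] = 0%E.
    apply/eqP; rewrite -measure_le0.
    by rewrite (le_trans (uniform_arrivals_le _))// lebesgue_measure_set1 mule0.
  by rewrite /= !(mulr0, addr0, mul0r).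
transitivity (\int[uniform_arrivals]_t (deviation_cost beta1 beta2 t)%:E)%E.
  apply: eq_integral => t _.
  rewrite (eq_integral (cst (deviation_cost beta1 beta2 t)%:E)); last first.
    by move=> u _; rewrite w0 addr0 /drop_cost subrr mulr0 addr0.
  by rewrite integral_cst//= lebesgue_measure_itv/= lte_fin ltr01 sube0 mule1.
rewrite integral_uniform; last 2 first.
- by apply/measurable_EFinP; exact: measurable_deviation_cost.
- by move=> x; rewrite lee_fin deviation_cost_ge0.
rewrite integral_deviation_cost// inv_width -EFinM; congr EFin.
have -> : beta1 * a ^+ 2 + beta2 * b ^+ 2 = L * (a + b).
  by rewrite mulrDr !expr2 [beta1 * _]mulrA [beta2 * _]mulrA {2}L_beta2.
by rewrite mulrA [_ * (L * _)]mulrCA rate_width mulr1.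
Qed.

(* The bathtub bound at level [L]: the triangle under [L] has mass [L / 2] for the
   density [mu / Lambda]. *)
Let residual_bound (P : arrival_distribution R) :
  (L%:E + \int[drop_law P]_(z in unit_strip R)
     (alpha * (departure Lambda mu P z - z.1) +
      Num.max (deviation_cost beta1 beta2 (departure Lambda mu P z) - L) 0)%:E <=
   \int[drop_law P]_(z in unit_strip R)
     (drop_cost alpha beta1 beta2 z.1 (departure Lambda mu P z))%:E + (L / 2)%:E)%E.
Proof.
have -> : L / 2 = mu / Lambda * (L * (a + b) / 2).
  by rewrite mulrA [_ * (L * _)]mulrCA rate_width mulr1.
rewrite [X in (_ <= _ + X)%E]EFinM
  -(integral_level_complement beta1_gt0 beta2_gt0 a_gt0 b_gt0 (erefl L) L_beta2).
exact: (cost_lower_bound P _ _ alpha_gt0 _ _ (ltW L_gt0)).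
Qed.

Let residual_ge0 P (z : R * R) : unit_strip R z ->
  0 <= alpha * (departure Lambda mu P z - z.1) +
      Num.max (deviation_cost beta1 beta2 (departure Lambda mu P z) - L) 0.
Proof.
move=> sz; rewrite addr_ge0 ?le_max ?lexx ?orbT//.
by rewrite mulr_ge0 ?(ltW alpha_gt0)// subr_ge0 arrival_le_departure.
Qed.

Lemma social_cost_ge (P : arrival_distribution R) :
  ((Lambda * (L / 2))%:E <= social_cost Lambda mu alpha beta1 beta2 P)%E.
Proof.
rewrite social_costE// EFinM lee_pmul2l//.
have -> : L / 2 = L - L / 2 by field.
rewrite EFinB leeBlDr//; apply: le_trans (residual_bound P).
by rewrite leeDl// integral_ge0// => z sz; rewrite lee_fin residual_ge0.
Qed.

(** If the lower bound is attained, the excess cost is null: almost all drops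
    depart on arrival, between [- a] and [b]. Hence [P] inherits the density bound of
    the departure times and is at most [uniform_arrivals] on every Borel set; two
    probabilities so ordered coincide. *)
Lemma social_cost_le_uniform (P : arrival_distribution R) :
  (social_cost Lambda mu alpha beta1 beta2 P <= (Lambda * (L / 2))%:E)%E ->
  same_distribution P uniform_arrivals.
Proof.
rewrite social_costE// EFinM lee_pmul2l// => costP.
set dep := departure Lambda mu P in costP *.
pose r (z : measurableTypeR R * measurableTypeR R) := alpha * (dep z - z.1) +
      Num.max (deviation_cost beta1 beta2 (dep z) - L) 0.
have mS : measurable (unit_strip R) by exact: measurableX.
have mr : measurable_fun (unit_strip R) (fun z => (r z)%:E).
  apply/measurable_EFinP/measurable_funTS; apply: measurable_funD.
    by apply: measurable_funM => //; apply: measurable_funB => //; exact: measurable_departure.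
  apply: measurable_maxr => //; apply: measurable_funB => //.
  apply: (measurableT_comp (measurable_deviation_cost _ _)).
  exact: measurable_departure.
have r0 : (\int[drop_law P]_(z in unit_strip R) `|(r z)%:E| = 0)%E.
  have -> : (\int[drop_law P]_(z in unit_strip R) `|(r z)%:E| =
      \int[drop_law P]_(z in unit_strip R) (r z)%:E)%E.
    by apply: eq_integral => z /set_mem sz; rewrite gee0_abs// lee_fin residual_ge0.
  apply/eqP; rewrite eq_le; apply/andP; split; last first.
    by apply: integral_ge0 => z sz; rewrite lee_fin residual_ge0.
  rewrite -(@leeD2lE _ L%:E)// adde0.
  rewrite (le_trans (residual_bound P))//.
  have -> : L%:E = ((L / 2)%:E + (L / 2)%:E)%E by rewrite -EFinD; congr EFin; field.
  by rewrite leeD2r.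
have /(ae_eq_integral_abs _ mS mr)[N [mN N0 sN]] := r0.
have PE A : measurable A -> P A = drop_law P (A `*` setT).
  by move=> mA; rewrite drop_lawX// probability_setT mule1.
have le A : measurable A -> (P A <= uniform_arrivals A)%E.
  move=> mA; rewrite uniform_arrivalsE//.
  have mAJ : measurable (A `&` `[- a, b]%classic) by exact: measurableI.
  apply: le_trans (departure_law_le P Lambda_gt0 mu_gt0 mAJ).
  have mD : measurable (departure Lambda mu P @^-1` (A `&` `[(- a)%R, b]%classic)).
    rewrite -[X in measurable X]setTI; exact: measurable_departure.
  rewrite PE// (drop_law_strip P (measurableX mA measurableT)).
  rewrite -[leRHS]adde0 -N0.
  apply: (@le_trans _ _ (drop_law P
     ((departure Lambda mu P @^-1` (A `&` `[(- a)%R, b]%classic)) `|` N))).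
    apply: le_measure; rewrite ?inE.
    - by apply: measurableI => //; exact: measurableX.
    - exact: measurableU.
    move=> z [sz [/= Az _]]; have [Nz|nNz] := pselect (N z); [by right|left].
    have rz : r z = 0.
      apply: contrapT => rz; apply: nNz; apply: sN => /= /(_ sz)[].
      exact: rz.
    have zd : z.1 <= dep z := arrival_le_departure P Lambda_gt0 mu_gt0 sz.
    have w0 : 0 <= alpha * (dep z - z.1) by rewrite mulr_ge0 ?subr_ge0// ltW.
    have m0 : 0 <= Num.max (deviation_cost beta1 beta2 (dep z) - L) 0.
      by rewrite le_max lexx orbT.
    have /andP[wz mz] : (alpha * (dep z - z.1) == 0) &&
        (Num.max (deviation_cost beta1 beta2 (dep z) - L) 0 == 0).
      by rewrite -paddr_eq0//; apply/eqP.
    have depE : dep z = z.1.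
      by apply/eqP; rewrite -subr_eq0; move: wz; rewrite mulf_eq0 gt_eqF.
    split; first by rewrite /= -/dep depE.
    rewrite /= -/dep -(deviation_cost_le_level beta1_gt0 beta2_gt0 a_gt0 b_gt0 _ (erefl L) L_beta2).
    by rewrite -subr_le0 -(eqP mz) le_max lexx.
  exact: measureU2.
(* The reverse inequality is [le] for the complement of [A]. *)
move=> A mA; apply/eqP; rewrite eq_le le//=.
have := le _ (measurableC mA); rewrite !probability_setC//.
by rewrite leeD2lE// leeN2.
Qed.

End optimum.

Unset Implicit Arguments.

Theorem theorem3 (R : realType) (Lambda mu alpha beta1 beta2 : R)
    (Lambda_gt0 : 0 < Lambda) (mu_gt0 : 0 < mu) (alpha_gt0 : 0 < alpha)
    (beta1_gt0 : 0 < beta1) (beta2_gt0 : 0 < beta2) :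
  exists P : arrival_distribution R,
    [/\ socially_optimal Lambda mu alpha beta1 beta2 P,
        forall P' : arrival_distribution R,
          socially_optimal Lambda mu alpha beta1 beta2 P' ->
          same_distribution P' P,
        has_density P (fun t : R => mu / Lambda *
          \1_`[- (beta2 * Lambda / ((beta1 + beta2) * mu)),
               beta1 * Lambda / ((beta1 + beta2) * mu)] t) &
        social_cost Lambda mu alpha beta1 beta2 P =
          (beta1 * beta2 * Lambda ^+ 2 / (2 * (beta1 + beta2) * mu))%:E].
Proof.
pose P := uniform_arrivals Lambda_gt0 mu_gt0 beta1_gt0 beta2_gt0.
have costP := uniform_arrivals_cost alpha Lambda_gt0 mu_gt0 beta1_gt0 beta2_gt0.
exists P; split.
- by move=> P'; rewrite costP; exact: social_cost_ge.
- move=> P' optP'; apply: (@social_cost_le_uniform _ _ _ alpha) => //.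
  by rewrite -costP; exact: optP'.
- exact: uniform_arrivals_density.
- rewrite costP; congr EFin; field.
  by rewrite !gt_eqF// addr_gt0.
Qed.
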